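(* Assume that $$\Delta^{(\nu+1)}=(d^{(\nu)}J+c^{(\nu)})\,\Delta^{(\nu)}$$ for some positive real numbers $c^{(\nu)},d^{(\nu)}$. Then $$\Phi^{(\alpha,\nu)}(x)=\bigl(W^{(\alpha,\nu)}(x)\bigr)^{-1}W^{(\alpha,\nu+1)}(x)$$ is a matrix valued polynomial of degree one.
   Context: $N\ge1$ is an integer. Scalars in matrix expressions denote multiples of the identity, and $^\ast$ is the conjugate transpose. $H_n$ are the Hermite polynomials defined by $\sum_{n\ge0}\frac{t^n}{n!}H_n(x)=e^{2xt-t^2}$. $L(x)$ is the lower triangular $N\times N$ matrix with $L(x)_{m,n}=\frac{H_{m-n}(x)}{(m-n)!}$ for $m\ge n$ and $0$ for $m<n$, $m,n\in\{1,\dots,N\}$. $\alpha_1,\dots,\alpha_N$ are non-zero real numbers with $\alpha_1=1$, $S^\alpha=\mathrm{diag}(\alpha_1,\dots,\alpha_N)$, $L^\alpha(x)=S^\alpha L(x)(S^\alpha)^{-1}$, $J=\mathrm{diag}(1,2,\dots,N)$. $\Delta^{(\nu)}=\mathrm{diag}(\delta_1^{(\nu)},\dots,\delta_N^{(\nu)})$ and $\Delta^{(\nu+1)}=\mathrm{diag}(\delta_1^{(\nu+1)},\dots,\delta_N^{(\nu+1)})$ are diagonal matrices with positive diagonal entries, and for $\kappa\in\{\nu,\nu+1\}$ $$W^{(\alpha,\kappa)}(x)=e^{-x^2}L^\alpha(x)\,\Delta^{(\kappa)}\,L^\alpha(x)^\ast,\qquad x\in\mathbb{R}.$$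
   Formalization: For N = 1 the function Φ is the constant d + c, of degree zero, so the formal theorem claims degree at most one for every N ≥ 1 and degree exactly one for N ≥ 2. *)

(* Defs.v *)
From HB Require Import structures.
From mathcomp Require Import all_boot all_order all_algebra.
From mathcomp Require Import all_classical all_reals all_analysis.
From mathcomp Require Import complex.

Set Implicit Arguments.
Unset Strict Implicit.
Unset Printing Implicit Defensive.

Import Order.TTheory GRing.Theory Num.Theory.
Import numFieldNormedType.Exports.

Local Open Scope classical_set_scope.
Local Open Scope ring_scope.
Local Open Scope complex_scope.
Local Open Scope sesquilinear_scope.

(* Pointwise convergence of the generating series at every x and t determines
   the family H uniquely. *)
Definition hermite_polynomials (R : realType) (H : nat -> {poly R}) : Prop :=
  forall x t : R,
    series (fun n : nat => t ^+ n / (n`!)%:R * (H n).[x]) @ \oo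
      --> expR (2 * x * t - t ^+ 2).

Definition diagC (R : realType) (N : nat) (v : 'rV[R]_N) : 'M[R[i]]_N :=
  diag_mx (\row_(j < N) (v 0 j)%:C).

(* Ordinals start at 0, whence the shift. *)
Definition Jmx (R : realType) (N : nat) : 'M[R[i]]_N :=
  diag_mx (\row_(j < N) (j.+1)%:R).

(* The entries only depend on the difference of the indices, so they may be
   counted from 0. *)
Definition Lmx (R : realType) (H : nat -> {poly R}) (N : nat) (x : R) :
    'M[R[i]]_N :=
  \matrix_(j < N, k < N)
    if (k <= j)%N then ((H (j - k)%N).[x] / ((j - k)`!)%:R)%:C else 0.

Definition Lalpha (R : realType) (H : nat -> {poly R}) (N : nat)
    (alpha : 'rV[R]_N) (x : R) : 'M[R[i]]_N :=
  diagC alpha *m Lmx H N x *m invmx (diagC alpha).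

Definition Weight (R : realType) (H : nat -> {poly R}) (N : nat)
    (alpha delta : 'rV[R]_N) (x : R) : 'M[R[i]]_N :=
  (expR (- x ^+ 2))%:C *:
    (Lalpha H alpha x *m diagC delta *m (Lalpha H alpha x)^t*).

Definition Phi (R : realType) (H : nat -> {poly R}) (N : nat)
    (alpha delta delta' : 'rV[R]_N) (x : R) : 'M[R[i]]_N :=
  invmx (Weight H alpha delta x) *m Weight H alpha delta' x.

(* Main.v *)
Require Import Defs.
From mathcomp Require Import all_boot all_order all_algebra.
From mathcomp Require Import all_classical all_reals all_analysis.
From mathcomp Require Import complex.
From mathcomp Require Import ring lra.

Import Order.TTheory GRing.Theory Num.Theory.
Import numFieldNormedType.Exports.

(** Write [L], [S], [A], [J] for the matrix of Hermite entries, the diagonal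
    matrix of the [alpha]'s, the lower shift and [diag(1, ..., N)], put
    [T = S L S^-1] and [E = d J + c].  The hypothesis on the two diagonal
    matrices reads [Delta' = Delta E], all three being diagonal, so the factors
    [exp(-x^2)], [T] and [Delta] cancel in the quotient of the weights:
    [Phi = (T^t)^-1 E T^t = (T E T^-1)^t]; here [T] is real, so its adjoint
    is its transpose ([PhiE]).

    It remains to see that [T E T^-1] has degree one in [x].  Since [S]
    commutes with [E], this amounts to
      [L J L^-1 = J - 2 x A + 2 A^2]         ([Lmx_intertwines_J]).
    The matrix [L] is a polynomial in [A], namely the truncation of the
    generating function [exp (2 x A - A^2)].  The commutator with [J] acts on
    such Toeplitz matrices as the Euler operator, multiplying the coefficient
    of [A^k] by [k] ([index_toeplitz_commutator]).  The displayed identity is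
    therefore, coefficientwise, the three-term recurrence
      [k h_k = 2 x h_(k-1) - 2 h_(k-2)],    [h_k = H_k(x) / k!]
    ([hermite_coef_rec]), which is the differential equation
    [f' = (2 x - 2 t) f] of [f(t) = exp (2 x t - t^2)] read on its power
    series.  As the Hermite polynomials are given only through pointwise
    convergence of the generating series, this last step rests on termwise
    differentiation of everywhere convergent power series
    ([sums_to_derive]) and on the uniqueness of their coefficients
    ([sums_to_eq0]).

    The coefficient of [x] in [Phi] is [- 2 d (S A S^-1)^t], which is non-zero
    as soon as [A] is, that is, when [N > 1]. *)

Local Open Scope classical_set_scope.
Local Open Scope ring_scope.
Local Open Scope complex_scope.

(** * Everywhere convergent power series *)

Section PowerSeries.
Set Implicit Arguments.
Unset Strict Implicit.
Variable R : realType.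
Implicit Types (a b : nat -> R) (f g : R -> R).

Definition sums_to a f := forall t : R, pseries a t @ \oo --> f t.

Lemma sums_toD a b f g :
  sums_to a f -> sums_to b g ->
  sums_to (fun k => a k + b k) (fun t => f t + g t).
Proof.
move=> af bg t.
have -> : pseries (fun k => a k + b k) t = pseries a t + pseries b t.
  rewrite /pseries -seriesD; congr series.
  by apply/funext => k; exact: mulrDl.
exact: cvgD.
Qed.

Lemma sums_toZ c a f :
  sums_to a f -> sums_to (fun k => c * a k) (fun t => c * f t).
Proof.
move=> af t.
have -> : pseries (fun k => c * a k) t = c *: pseries a t.
  rewrite /pseries -seriesZ; congr series.
  by apply/funext => k; exact/esym/mulrA.
exact: cvgMl_tmp.
Qed.

(** The coefficients of [t * f t] when [a] are those of [f]; also the first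
    column of [shift_mx *m toeplitz a]. *)
Definition shift_seq {K : nmodType} (a : nat -> K) (k : nat) : K :=
  if k is k'.+1 then a k' else 0.

Lemma sums_to_shift a f :
  sums_to a f -> sums_to (shift_seq a) (fun t => t * f t).
Proof.
move=> af t; rewrite /pseries -cvg_shiftS.
rewrite [X in X @ _ --> _](_ : _ = (fun k => t * pseries a t k)).
  exact: cvgMl_tmp.
apply/funext => k; rewrite /pseries /series /= big_nat_recl //= mul0r add0r.
by rewrite mulr_sumr; apply: eq_bigr => i _; rewrite exprS mulrCA.
Qed.

Lemma is_cvg_series_shift a :
  cvgn (series a) -> cvgn (series (fun k => a k.+1)).
Proof.
have -> : series (fun k => a k.+1) = (fun k => series a k.+1 - a 0%N).
  by apply/funext => k; rewrite /series /= big_nat_recl // addrC addKr.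
move=> /cvg_ex[l al]; apply/cvg_ex; exists (l - a 0%N).
by apply: cvgB; [rewrite cvg_shiftS|exact: cvg_cst].
Qed.

(** From [k + 1 <= 2^(k+1)], the terms [(k + 1) a_(k+1) r^k] are dominated by
    [1 / r] times those of the series of [a] at [2 r], which converges
    absolutely because the series of [a] still converges beyond [2 r]. *)
Lemma is_cvg_pseries_diffs a :
  (forall t, cvgn (pseries a t)) -> forall t, cvgn (pseries (pseries_diffs a) t).
Proof.
move=> ca t; set r := `|t| + 1.
have r_gt0 : 0 < r by rewrite ltr_wpDl.
apply: (@is_cvg_pseries_inside _ _ r); last first.
  by rewrite (gtr0_norm r_gt0) ltrDl.
apply: normed_cvg.
have c2r : cvgn (pseries (fun k => `|a k|) (2 * r)).
  apply: (@is_cvg_pseries_inside_norm _ _ (2 * r + 1)); first exact: ca.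
  rewrite !gtr0_norm; lra.
have := @is_cvg_seriesZ _ _ r^-1 (is_cvg_series_shift c2r).
apply: series_le_cvg => k /=.
- exact: normr_ge0.
- by rewrite /GRing.scale /= !mulr_ge0 ?invr_ge0 ?exprn_ge0 ?mulr_ge0 // ltW.
- rewrite /pseries_diffs !normrM normrX normr_nat (gtr0_norm r_gt0).
  rewrite [leRHS](_ : _ = 2 ^+ k.+1 * `|a k.+1| * r ^+ k).
    rewrite ler_wpM2r ?exprn_ge0 ?(ltW r_gt0) // ler_wpM2r ?normr_ge0 //.
    by rewrite -natrX ler_nat ltnW // ltn_expl.
  rewrite -[LHS]/(r^-1 * (`|a k.+1| * (2 * r) ^+ k.+1)).
  rewrite exprMn (exprS r) mulrCA (mulrCA (2 ^+ _)).
  by rewrite mulKf ?gt_eqF // mulrA (mulrC (2 ^+ _)).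
Qed.

(** Termwise differentiation requires the first and second derived series to
    converge at a point beyond [t]: everywhere convergence provides this. *)
Lemma sums_to_derive a f f' :
  sums_to a f -> (forall t, is_derive t (1 : R) f (f' t)) ->
  sums_to (pseries_diffs a) f'.
Proof.
move=> af df t.
have ca s : cvgn (pseries a s) by apply/cvg_ex; exists (f s); exact: af.
have cda := is_cvg_pseries_diffs ca; have cdda := is_cvg_pseries_diffs cda.
have := @pseries_snd_diffs _ a (`|t| + 1) t (ca _) (cda _) (cdda _).
have -> : (fun x => limn (pseries a x)) = f.
  by apply/funext => s; apply/cvg_lim => //; exact: af.
have t_lt : `|t| < `| `|t| + 1 | by rewrite [ltRHS]ger0_norm ?addr_ge0 // ltrDl.
move=> /(_ t_lt) lim_diffs.
rewrite -(@derive_val _ _ _ _ _ _ _ (df t)).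
by rewrite (@derive_val _ _ _ _ _ _ _ lim_diffs); exact: cda.
Qed.

Lemma sums_to_at0 a f : sums_to a f -> f 0 = a 0%N.
Proof.
move=> /(_ 0) a0; suff {a0} : pseries a 0 @ \oo --> a 0%N.
  by apply: cvg_unique a0.
rewrite -cvg_shiftS; apply: cvg_near_cst; near=> k.
rewrite /pseries /series /= big_nat_recl //= mulr1 big1 ?addr0 // => i _.
by rewrite exprS mul0r mulr0.
Unshelve. all: by end_near. Qed.

(** The hypothesis passes to the derived series, whose [k]-th coefficient is
    [(k + 1) a_(k+1)]: hence an induction on [k] over all sequences, the
    value at [0] giving the base case. *)
Lemma sums_to_eq0 a : sums_to a (cst 0) -> forall k, a k = 0.
Proof.
move=> a0 k; elim: k a a0 => [|k IHk] a a0; first by rewrite -(sums_to_at0 a0).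
have /IHk/eqP : sums_to (pseries_diffs a) (cst 0).
  by apply: sums_to_derive a0 _ => t; exact: is_derive_cst.
by rewrite /pseries_diffs mulf_eq0 pnatr_eq0 /= => /eqP.
Qed.

End PowerSeries.

(** * The recurrence of the Hermite coefficients *)

Section Hermite.
Set Implicit Arguments.
Unset Strict Implicit.
Variables (R : realType) (H : nat -> {poly R}).
Hypothesis hH : hermite_polynomials H.

Definition hermite_coef (x : R) (k : nat) : R := (H k).[x] / k`!%:R.

Lemma hermite_coef_sums_to x :
  sums_to (hermite_coef x) (fun t => expR (2 * x * t - t ^+ 2)).
Proof.
move=> t; have -> : pseries (hermite_coef x) t
    = series (fun k => t ^+ k / k`!%:R * (H k).[x]).
  by congr series; apply/funext => k; rewrite /hermite_coef mulrC mulrA mulrAC.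
by have := @hH x t.
Qed.

Lemma hermite_coef0 x : hermite_coef x 0 = 1.
Proof.
rewrite -(sums_to_at0 (@hermite_coef_sums_to x)).
by rewrite mulr0 expr0n subrr expR0.
Qed.

(** With [f t = exp (2 x t - t^2)], the function [f' - 2 x f + 2 t f] vanishes
    identically; its [k]-th coefficient gives the relation of index [k + 1],
    the one of index [0] being [0 = 0]. *)
Lemma hermite_coef_rec x k :
  k%:R * hermite_coef x k = 2 * x * shift_seq (hermite_coef x) k
    - 2 * shift_seq (shift_seq (hermite_coef x)) k.
Proof.
set h := hermite_coef x; set f := fun t => expR (2 * x * t - t ^+ 2).
have hf : sums_to h f := @hermite_coef_sums_to x.
have df t : is_derive t (1 : R) f ((2 * x - 2 * t) * f t).
  have dg : is_derive t (1 : R) ((2 * x) \*: id - id ^+ 2) (2 * x - 2 * t).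
    apply: is_derive_eq; rewrite /GRing.scale /= expr1 !mulr1 //.
  rewrite (mulrC _ (f t)); exact: is_derive1_comp (is_derive_expR _) dg.
case: k => [|k]; first by rewrite /= !mulr0 subrr mul0r.
apply/eqP; rewrite -subr_eq0; apply/eqP.
suff /sums_to_eq0/(_ k) : sums_to
    (fun k => pseries_diffs h k + (- (2 * x) * h k + 2 * shift_seq h k)) (cst 0).
  by rewrite /pseries_diffs /= => <-; ring.
have := sums_toD (sums_to_derive hf df)
  (sums_toD (@sums_toZ _ (- (2 * x)) _ _ hf) (@sums_toZ _ 2 _ _ (sums_to_shift hf))).
by congr (sums_to _ _); apply/funext => t /=; ring.
Qed.

End Hermite.

(** * Lower triangular Toeplitz matrices *)

Section Toeplitz.
Set Implicit Arguments.
Unset Strict Implicit.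
Variables (K : comNzRingType) (N : nat).
Implicit Type a b : nat -> K.

Definition toeplitz a : 'M[K]_N :=
  \matrix_(j < N, k < N) if (k <= j)%N then a (j - k)%N else 0.

Definition shift_mx : 'M[K]_N := \matrix_(j < N, k < N) (j == k.+1 :> nat)%:R.

Definition index_mx : 'M[K]_N := diag_mx (\row_j j.+1%:R).

Lemma shift_mul_toeplitz a : shift_mx *m toeplitz a = toeplitz (shift_seq a).
Proof.
apply/matrixP => j k; rewrite !mxE.
have [j0|j_gt0] := posnP j.
  rewrite big1 => [|i _]; first by rewrite j0; case: ifP => // /[!leqn0] /eqP ->.
  by rewrite !mxE j0 mul0r.
have pj : (j.-1 < N)%N by rewrite (leq_ltn_trans (leq_pred j)).
rewrite (bigD1 (Ordinal pj)) //= big1 ?addr0 => [|i neq_i]; rewrite !mxE /=.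
  rewrite prednK // eqxx mul1r.
  case: leqP => [k_le|lt_jk].
    rewrite (leq_trans k_le (leq_pred j)) /=.
    by rewrite -{2}(prednK j_gt0) subSn.
  have : (k <= j)%N -> (j - k = 0)%N.
    by move=> kj; apply/eqP; rewrite subn_eq0 -(prednK j_gt0).
  by case: ifP => // kj /(_ isT) ->.
case: eqP => [ji|_]; last by rewrite mul0r.
by case/eqP: neq_i; apply: val_inj; rewrite /= ji.
Qed.

(** The entry [(j, k)] is multiplied by [j + 1] on one side and by [k + 1] on
    the other, and the difference depends on [j - k] only. *)
Lemma index_toeplitz_commutator a :
  index_mx *m toeplitz a - toeplitz a *m index_mx
  = toeplitz (fun k => k%:R * a k).
Proof.
apply/matrixP => j k; rewrite mul_diag_mx mul_mx_diag !mxE.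
case: leqP => [kj|_]; last by rewrite mulr0 mul0r subrr.
by rewrite natrB // -!natr1; ring.
Qed.

Lemma toeplitzD a b : toeplitz (fun k => a k + b k) = toeplitz a + toeplitz b.
Proof. by apply/matrixP => j k; rewrite !mxE; case: ifP; rewrite ?addr0. Qed.

Lemma toeplitzZ c a : toeplitz (fun k => c * a k) = c *: toeplitz a.
Proof. by apply/matrixP => j k; rewrite !mxE; case: ifP; rewrite ?mulr0. Qed.

Lemma det_toeplitz a : \det (toeplitz a) = a 0%N ^+ N.
Proof.
rewrite det_trig; last by apply/is_trig_mxP => j k jk; rewrite mxE leqNgt jk.
under eq_bigr => j _ do rewrite mxE leqnn subnn.
by rewrite prodr_const card_ord.
Qed.

End Toeplitz.

(** * The weights and their quotient *)

Section Weights.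
Set Implicit Arguments.
Unset Strict Implicit.
Variables (R : realType) (H : nat -> {poly R}).
Hypothesis hH : hermite_polynomials H.

Lemma LmxE N x : Lmx H N x = toeplitz N (fun k => (hermite_coef H x k)%:C).
Proof. by []. Qed.

Lemma Lmx_unit N x : Lmx H N x \in unitmx.
Proof. by rewrite LmxE unitmxE det_toeplitz hermite_coef0 // expr1n unitr1. Qed.

(** In terms of coefficient sequences, [J L - L J = 2 x A L - 2 A^2 L] is the
    recurrence of the Hermite coefficients. *)
Lemma Lmx_intertwines_J N x :
  Lmx H N x *m Jmx R N =
  (Jmx R N - (2 * x%:C) *: shift_mx _ N + 2 *: (shift_mx _ N *m shift_mx _ N))
    *m Lmx H N x.
Proof.
set L := Lmx H N x; set A := shift_mx _ N.
suff commJL : Jmx R N *m L - L *m Jmx R N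
    = (2 * x%:C) *: (A *m L) - 2 *: (A *m (A *m L)).
  rewrite mulmxDl mulmxBl -!scalemxAl -mulmxA.
  by rewrite -[LHS](subKr (Jmx R N *m L)) commJL opprB addrA addrAC.
rewrite /L LmxE index_toeplitz_commutator !shift_mul_toeplitz -scaleNr.
rewrite -!toeplitzZ -toeplitzD; congr toeplitz; apply/funext => k.
have -> : k%:R * (hermite_coef H x k)%:C = (k%:R * hermite_coef H x k)%:C :> R[i].
  by rewrite [RHS]rmorphM /= (rmorph_nat (real_complex R)).
rewrite hermite_coef_rec //; case: k => [|[|k]] /=;
  rewrite ?(rmorphB, rmorphM, rmorph0, rmorph_nat) /=.
all: ring.
Qed.

Lemma diagC_unit N (v : 'rV[R]_N) :
  (forall j, v 0 j != 0) -> diagC v \in unitmx.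
Proof.
move=> v_neq0; rewrite unitmxE det_diag unitfE prodf_seq_neq0.
by apply/allP => j _; rewrite mxE fmorph_eq0 v_neq0.
Qed.

Lemma conj_diagC N (v : 'rV[R]_N) : map_mx Num.conj (diagC v) = diagC v.
Proof.
rewrite map_diag_mx; congr diag_mx; apply/rowP => j; rewrite !mxE.
by apply/CrealP/complex_realP; exists (v 0 j).
Qed.

Lemma conj_Lmx N x : map_mx Num.conj (Lmx H N x) = Lmx H N x.
Proof.
apply/matrixP => j k; rewrite !mxE; case: ifP => _; last exact: rmorph0.
by apply/CrealP/complex_realP; eexists.
Qed.

Lemma conj_Lalpha N (alpha : 'rV[R]_N) x :
  map_mx Num.conj (Lalpha H alpha x) = Lalpha H alpha x.
Proof. by rewrite /Lalpha !map_mxM map_invmx conj_diagC conj_Lmx. Qed.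

Lemma Lalpha_unit N (alpha : 'rV[R]_N) x :
  (forall j, alpha 0 j != 0) -> Lalpha H alpha x \in unitmx.
Proof.
by move=> /diagC_unit uS; rewrite !unitmx_mul Lmx_unit unitmx_inv uS.
Qed.

Lemma WeightE N (alpha delta : 'rV[R]_N) x :
  Weight H alpha delta x = (expR (- x ^+ 2))%:C *:
    (Lalpha H alpha x *m diagC delta *m (Lalpha H alpha x)^T).
Proof. by rewrite /Weight -map_trmx conj_Lalpha. Qed.

Lemma Weight_unit N (alpha delta : 'rV[R]_N) x :
  (forall j, alpha 0 j != 0) -> (forall j, delta 0 j != 0) ->
  Weight H alpha delta x \in unitmx.
Proof.
move=> alpha0 delta0; have uT := Lalpha_unit x alpha0.
rewrite WeightE unitmxZ; last by rewrite unitfE fmorph_eq0 gt_eqF ?expR_gt0.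
by rewrite 2!unitmx_mul unitmx_tr uT diagC_unit.
Qed.

(** With [E] symmetric, [T E = Q T] turns [T Delta E T^t] into [(T Delta T^t) Q^t]: the second
    weight is the first one times [Q^t]. *)
Lemma PhiE N (alpha delta delta' : 'rV[R]_N) (E Q : 'M[R[i]]_N) x :
  (forall j, alpha 0 j != 0) -> (forall j, delta 0 j != 0) ->
  diagC delta' = diagC delta *m E -> E^T = E ->
  Lalpha H alpha x *m E = Q *m Lalpha H alpha x ->
  Phi H alpha delta delta' x = Q^T.
Proof.
move=> alpha0 delta0 deltaE symE LE.
rewrite /Phi -[RHS](mulKmx (Weight_unit x alpha0 delta0)); congr (_ *m _).
rewrite !WeightE deltaE -scalemxAl; congr (_ *: _).
move: (Lalpha H alpha x) LE => T TE.
by rewrite -!mulmxA -trmx_mul -TE trmx_mul symE.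
Qed.

Lemma affine_index_diag N (c d : R) :
  d%:C *: Jmx R N + (c%:C)%:M = diag_mx (\row_j (d%:C * j.+1%:R + c%:C)).
Proof.
apply/matrixP => j k; rewrite !mxE.
by case: eqP => _; rewrite ?mulr1n // !mulr0n mulr0 addr0.
Qed.

(** The diagonal matrix [S] commutes with [E], so conjugating the intertwining
    relation of [L] by [S] affects only the powers of [A]. *)
Lemma Lalpha_intertwines N (alpha : 'rV[R]_N) (c d x : R) :
  (forall j, alpha 0 j != 0) ->
  let S := diagC alpha in
  let A := shift_mx R[i] N in
  let E := d%:C *: Jmx R N + (c%:C)%:M in
  Lalpha H alpha x *m E =
  (S *m (E - (2 * d%:C * x%:C) *: A + (2 * d%:C) *: (A *m A)) *m invmx S)
    *m Lalpha H alpha x.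
Proof.
move=> /diagC_unit uS S A E; set L := Lmx H N x.
have LE : L *m E =
    (E - (2 * d%:C * x%:C) *: A + (2 * d%:C) *: (A *m A)) *m L.
  rewrite mulmxDr -scalemxAr Lmx_intertwines_J -/L -/A scalar_mxC.
  rewrite (scalemxAl d%:C) -mulmxDl; congr (_ *m _).
  rewrite !scalerDr scalerN !scalerA /E.
  rewrite (mulrC _ 2) [d%:C * _]mulrCA mulrA.
  by rewrite addrAC (addrAC _ _ c%:C%:M).
have SE : invmx S *m E = E *m invmx S.
  have ES : E *m S = S *m E by rewrite /E affine_index_diag /S /diagC diag_mxC.
  by rewrite -[LHS](mulmxK uS) -(mulmxA _ E) ES (mulmxA (invmx S)) mulVmx // mul1mx.
rewrite /Lalpha -/S -/L -!mulmxA SE (mulmxA L) LE (mulmxA (invmx S)).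
by rewrite mulVmx // mul1mx !mulmxA.
Qed.

End Weights.

Theorem proposition3p6 (R : realType) (H : nat -> {poly R})
    (hH : hermite_polynomials H)
    (n : nat) (alpha delta_nu delta_nu1 : 'rV[R]_n.+1)
    (halpha : forall j : 'I_n.+1, alpha 0 j != 0)
    (halpha1 : alpha 0 ord0 = 1)
    (hdelta_nu : forall j : 'I_n.+1, 0 < delta_nu 0 j)
    (hdelta_nu1 : forall j : 'I_n.+1, 0 < delta_nu1 0 j)
    (c d : R) (hc : 0 < c) (hd : 0 < d)
    (hrec : diagC delta_nu1 =
            (d%:C *: Jmx R n.+1 + (c%:C)%:M) *m diagC delta_nu) :
  exists P : {poly 'M[R[i]]_n.+1},
    [/\ forall x : R, Phi H alpha delta_nu delta_nu1 x = P.[(x%:C)%:M],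
        (size P <= 2)%N
      & (1 < n.+1)%N -> size P = 2%N].
Proof.
set E := _ + _ in hrec; set S := diagC alpha; set A := shift_mx R[i] n.+1.
pose C0 := (S *m (E + (2 * d%:C) *: (A *m A)) *m invmx S)^T.
pose C1 := (- (2 * d%:C) *: (S *m A *m invmx S))^T.
have uS : S \in unitmx by exact: diagC_unit.
exists (C1%:P * 'X + C0%:P); split.
- move=> x; rewrite hornerMXaddC hornerC.
  rewrite (@PhiE _ _ hH _ _ _ _ E _ x halpha _ _ _
    (@Lalpha_intertwines _ _ hH _ _ c d x halpha)).
  + rewrite /C0 /C1 -/E -/S -/A.
    rewrite -/E -/S -/A -mulmxE scalar_mxC mul_scalar_mx.
    apply: trmx_inj; rewrite [RHS]linearD [in RHS]linearZ /= !trmxK.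
    rewrite (addrAC E) (mulmxDr S) (mulmxDl (S *m _)) [RHS]addrC; congr (_ + _).
    by rewrite -scaleNr -scalemxAr -scalemxAl scalerA [x%:C * _]mulrC mulNr.
  + by move=> j; rewrite gt_eqF.
  + by rewrite hrec /E affine_index_diag diag_mxC.
  + by rewrite /E affine_index_diag tr_diag_mx.
- by rewrite size_MXaddC; case: ifP => // _; rewrite ltnS size_polyC leq_b1.
- move=> n_gt0; rewrite size_MXaddC size_polyC polyC_eq0.
  suff C1_neq0 : C1 != 0 by rewrite (negPf C1_neq0).
  have A_neq0 : A != 0.
    apply/eqP => /matrixP/(_ (Ordinal n_gt0) ord0)/eqP.
    by rewrite !mxE /= oner_eq0.
  rewrite trmx_eq0 scalemx_eq0 oppr_eq0 mulf_eq0 pnatr_eq0 /= fmorph_eq0.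
  rewrite (gt_eqF hd) /=; apply: contraNneq A_neq0 => SAS.
  by rewrite -(mulKmx uS A) -(mulmxKV uS (S *m A)) SAS mul0mx mulmx0.
Qed.
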